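(* Fix integers $n\ge 1$ and $q\geq 1$. Suppose $\ell\ge n$ is the smallest integer such that $\tilde{H}_q(\mathcal{VR}(\mathcal{F}_n^{[\ell]};2(n-1)))$ is nontrivial. Then for every $m\geq\ell$, $$\operatorname{rank}\tilde{H}_q\big(\mathcal{VR}(\mathcal{F}_n^{[m]};2(n-1))\big)\geq\sum_{i=\ell}^{m}\binom{i-2}{\ell-2}\cdot\operatorname{rank}\tilde{H}_q\big(\mathcal{VR}(\mathcal{F}_n^{[\ell]};2(n-1))\big).$$
   Context: $\mathcal{F}_n^{[m]}$ is the set of $n$-element subsets of $[m]=\{1,\dots,m\}$ with metric $d(A,B)=|A\triangle B|$. $\mathcal{VR}(X;r)$ is the simplicial complex on $X$ whose simplices are nonempty finite sets of pairwise distance $\le r$. Note $\mathcal{VR}(\mathcal{F}_n^{[2n+k]};2(n-1))$ is the independence complex of the Kneser graph $\mathrm{KG}(n,k)$. $\tilde H_q$ denotes reduced simplicial homology with real coefficients, and rank means dimension. *)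

(* Defs.v *)
From HB Require Import structures.
From mathcomp Require Import all_boot all_order all_algebra.
From mathcomp Require Import reals.

Set Implicit Arguments.
Unset Strict Implicit.
Unset Printing Implicit Defensive.

Import GRing.Theory.
Local Open Scope ring_scope.

Section Homology.
Variables (F : fieldType) (V : finType).

Definition simplicial_complex (K : {set {set V}}) : Prop :=
  set0 \notin K /\
  (forall s t : {set V}, s \in K -> t != set0 -> t \subset s -> t \in K).

(* Ambient space of all chains; the subspaces [chains K q] below cut out the
   chains of a complex.  The coordinate at [set0] is the target of the
   augmentation map. *)
Definition chain := {ffun {set V} -> F^o}.

Definition elem_chain (s : {set V}) : chain := [ffun t => (t == s)%:R].

(* Every simplex is oriented by the enumeration order of the vertices:
   [vertex_pos v s] is the index of [v] among the increasingly listed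
   vertices of [s]. *)
Definition vertex_pos (v : V) (s : {set V}) : nat :=
  #|[set u in s | (enum_rank u < enum_rank v)%N]|.

(* A vertex has boundary [elem_chain set0], so that this differential is the
   augmentation in degree 0: the homology below is the reduced one. *)
Definition simplex_boundary (s : {set V}) : chain :=
  \sum_(v in s) (-1) ^+ vertex_pos v s *: elem_chain (s :\ v).

Definition boundary_fun (c : chain) : chain :=
  \sum_(s : {set V}) c s *: simplex_boundary s.

Lemma boundary_fun_is_linear : linear boundary_fun.
Proof.
move=> a c d; rewrite /boundary_fun scaler_sumr -big_split /=.
by apply: eq_bigr => s _; rewrite !ffunE scalerDl scalerA.
Qed.

HB.instance Definition _ :=
  GRing.isLinear.Build F chain chain _ boundary_fun boundary_fun_is_linear.

Definition boundary : 'End(chain) := linfun boundary_fun.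

Definition chains (K : {set {set V}}) (q : nat) : {vspace chain} :=
  <<[seq elem_chain s | s <- enum [set s in K | #|s| == q.+1]]>>%VS.

Definition cycles (K : {set {set V}}) (q : nat) : {vspace chain} :=
  (chains K q :&: lker boundary)%VS.

Definition boundaries (K : {set {set V}}) (q : nat) : {vspace chain} :=
  (boundary @: chains K q.+1)%VS.

(* The homology is the quotient of [cycles K q] by [boundaries K q], which is
   a subspace by [boundaries_sub_cycles]. *)
Definition homology_nontrivial (K : {set {set V}}) (q : nat) : Prop :=
  cycles K q <> boundaries K q.

Definition homology_rank (K : {set {set V}}) (q : nat) : nat :=
  (\dim (cycles K q) - \dim (boundaries K q))%N.

Lemma boundary_elem (s : {set V}) :
  boundary (elem_chain s) = simplex_boundary s.
Proof.
rewrite lfunE /= /boundary_fun (bigD1 s) //= big1 => [|t /negPf ts].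
  by rewrite addr0 ffunE eqxx scale1r.
by rewrite ffunE ts scale0r.
Qed.

Lemma vertex_posD1 (v w : V) (s : {set V}) : w \in s ->
  vertex_pos v s
    = ((enum_rank w < enum_rank v)%N + vertex_pos v (s :\ w))%N.
Proof.
move=> ws; rewrite /vertex_pos (cardsD1 w) !inE ws /=; congr (_ + _)%N.
by apply: eq_card => u; rewrite !inE andbA.
Qed.

Lemma boundary_boundary (c : chain) : boundary (boundary c) = 0.
Proof.
suff H s : boundary (simplex_boundary s) = 0.
  rewrite [boundary c]lfunE /= /boundary_fun linear_sum big1 // => s _.
  by rewrite linearZ /= H scaler0.
pose f v w : chain :=
  ((-1) ^+ vertex_pos v s * (-1) ^+ vertex_pos w (s :\ v))
    *: elem_chain (s :\ v :\ w).
have fN v w : v \in s -> w \in s -> w != v -> f v w = - f w v.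
  move=> vs ws nwv; rewrite /f -scaleNr.
  have -> : s :\ v :\ w = s :\ w :\ v.
    by apply/setP => u; rewrite !inE andbCA.
  congr (_ *: _); rewrite (vertex_posD1 v ws) (vertex_posD1 w vs) !exprD.
  have : (enum_rank w != enum_rank v :> nat).
    by apply: contra nwv => /eqP/val_inj/enum_rank_inj ->.
  rewrite -!mulrA; case: ltngtP => // _ _.
    by rewrite expr0 expr1 !mulNr !mul1r mulrC.
  by rewrite expr0 expr1 !mulNr !mul1r opprK mulrC.
pose i (v : V) : nat := enum_rank v.
have -> : boundary (simplex_boundary s)
    = \sum_(v in s) \sum_(w in s | w != v) f v w.
  rewrite linear_sum; apply: eq_bigr => v vs.
  rewrite linearZ /= boundary_elem /simplex_boundary scaler_sumr.
  by apply: eq_big => [w|w _]; rewrite ?inE 1?andbC // scalerA.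
have split_sum v : v \in s -> \sum_(w in s | w != v) f v w
    = \sum_(w in s | (i w < i v)%N) f v w
      + \sum_(w in s | (i v < i w)%N) f v w.
  move=> vs; rewrite (bigID (fun w => (i w < i v)%N)) /=.
  congr (_ + _); apply: eq_bigl => w; rewrite -andbA; congr (_ && _);
    rewrite -(inj_eq enum_rank_inj) -val_eqE /= -/(i w) -/(i v);
    by case: ltngtP.
rewrite (eq_bigr _ split_sum) big_split /= [X in X + _](exchange_big_dep
  (fun w => w \in s)) /=; last by move=> v w _ /andP[].
rewrite -big_split big1 // => v vs /=.
apply/eqP; rewrite addr_eq0 -sumrN; apply/eqP; apply: eq_big => [w|w].
  by rewrite vs.
case/andP=> ws /andP[_ lt_vw]; apply: fN => //.
by apply: contraTneq lt_vw => ->; rewrite ltnn.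
Qed.

Lemma boundary_chains (K : {set {set V}}) (q : nat) :
  simplicial_complex K -> (boundaries K q <= chains K q)%VS.
Proof.
move=> [_ Kdown]; rewrite /boundaries limg_span; apply/span_subvP => c.
case/mapP=> x /mapP[s + ->] ->; rewrite mem_enum inE => /andP[sK /eqP sq].
rewrite boundary_elem; apply: memv_suml => v vs; apply/memvZ/memv_span.
apply/map_f; rewrite mem_enum inE.
have cv : #|s :\ v| = q.+1 by have := cardsD1 v s; rewrite vs sq => -[->].
by rewrite cv eqxx andbT (Kdown s) ?subD1set // -card_gt0 cv.
Qed.

Lemma boundaries_sub_cycles (K : {set {set V}}) (q : nat) :
  simplicial_complex K -> (boundaries K q <= cycles K q)%VS.
Proof.
move=> Kc; rewrite subv_cap boundary_chains //=.
apply/subvP => x /memv_imgP[c _ ->].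
by rewrite memv_ker boundary_boundary.
Qed.

Lemma homology_nontrivialP (K : {set {set V}}) (q : nat) :
  simplicial_complex K ->
  homology_nontrivial K q <-> (0 < homology_rank K q)%N.
Proof.
move=> /(boundaries_sub_cycles q) BZ; rewrite subn_gt0 ltnNge.
split=> [H|/negP H E]; last by apply: H; rewrite E.
apply/negP => le; apply: H; apply/esym/eqP; rewrite eqEdim BZ; exact: le.
Qed.

End Homology.

Definition vietoris_rips (T : finType) (d : T -> T -> nat) (X : {set T})
    (r : nat) : {set {set T}} :=
  [set s : {set T} | [&& s != set0, s \subset X
     & [forall a in s, forall b in s, (d a b <= r)%N]]].

Lemma vietoris_rips_complex (T : finType) (d : T -> T -> nat) (X : {set T})
  (r : nat) : simplicial_complex (vietoris_rips d X r).
Proof.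
split=> [|s t]; rewrite !inE ?eqxx // => /and3P[_ sX /forall_inP sd] t0 ts.
rewrite t0 (subset_trans ts sX); apply/forall_inP => a /(subsetP ts) sa.
apply/forall_inP => b /(subsetP ts) sb.
by have /forall_inP := sd a sa; apply.
Qed.

Definition symdiff_dist (T : finType) (A B : {set T}) : nat :=
  #|(A :\: B) :|: (B :\: A)|.

(* [m] is represented by 'I_m = {0, ..., m - 1}. *)
Definition n_subsets (n m : nat) : {set {set 'I_m}} :=
  [set A : {set 'I_m} | #|A| == n].

Definition VR_subsets (n m r : nat) : {set {set {set 'I_m}}} :=
  vietoris_rips (@symdiff_dist 'I_m) (n_subsets n m) r.

(* Main.v *)
(* Idea.  Two n-sets are at distance at most 2(n-1) iff they meet, so a map
   f : [a] -> [b] with n <= b induces simplicial maps by sending an n-set A to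
   any n-set containing f(A); all choices are contiguous.  Hence reduced
   homology is a functor on the finite sets of size at least n, and by
   minimality of l every non-surjective f : [l] -> [l] acts as zero, since it
   factors through a set of size l-1.

   An (l-1)-subset T of {0, ..., m-2} gives the step function
   r_T(x) = #{t in T | t < x} from [m] onto [l] and its least section s_T.
   Then r_T s_T = id, and r_T s_U is injective only if r_U <= r_T pointwise.
   So the matrix (r_T s_U)_* is block unitriangular, which embeds
   C(m-1, l-1) copies of the homology for l into the homology for m; the
   hockey-stick identity rewrites the binomial as the sum of the theorem. *)
From HB Require Import structures.
Require Import Defs.
From mathcomp Require Import all_boot all_order all_algebra.
From mathcomp Require Import zify.
From mathcomp Require Import reals.

Set Implicit Arguments.
Unset Strict Implicit.
Unset Printing Implicit Defensive.

Import GRing.Theory.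
Local Open Scope ring_scope.

(** * Linear maps on chains prescribed on simplices *)

Section LinearExtension.
Variables (F : fieldType) (V W : finType).

Definition lin_ext_fun (g : {set V} -> chain F W) (c : chain F V) :
  chain F W := \sum_(s : {set V}) c s *: g s.

Lemma lin_ext_fun_is_linear g : linear (lin_ext_fun g).
Proof.
move=> a c d; rewrite /lin_ext_fun scaler_sumr -big_split /=.
by apply: eq_bigr => s _; rewrite !ffunE scalerDl scalerA.
Qed.

HB.instance Definition _ g :=
  GRing.isLinear.Build F (chain F V) (chain F W) _ (lin_ext_fun g)
    (lin_ext_fun_is_linear g).

Definition lin_ext g : 'Hom(chain F V, chain F W) := linfun (lin_ext_fun g).

Lemma lin_ext_elem g s : lin_ext g (elem_chain F s) = g s.
Proof.
rewrite lfunE /= /lin_ext_fun (bigD1 s) //= big1 => [|t /negPf ts].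
  by rewrite addr0 ffunE eqxx scale1r.
by rewrite ffunE ts scale0r.
Qed.

Lemma chain_sum (c : chain F V) :
  c = \sum_(s : {set V}) c s *: elem_chain F s.
Proof.
apply/ffunP => t; rewrite sum_ffunE (bigD1 t) //= big1 => [|s /negPf ts].
  by rewrite addr0 !ffunE eqxx [_ *: _]mulr1.
by rewrite !ffunE eq_sym ts [_ *: _]mulr0.
Qed.

Lemma hom_eq_elem (f g : 'Hom(chain F V, chain F W)) :
  (forall s, f (elem_chain F s) = g (elem_chain F s)) -> f = g.
Proof.
move=> fg; apply/lfunP => c; rewrite (chain_sum c) !linear_sum.
by apply: eq_bigr => s _; rewrite !linearZ /= fg.
Qed.

End LinearExtension.

(** * Exterior multiplication by a vertex *)

Section Wedge.
Variables (F : fieldType) (V : finType).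
Implicit Types (v w : V) (s : {set V}) (c : chain F V).
Local Notation elem := (@elem_chain F V).

(* Chains form the exterior algebra on [V], with unit [elem_chain set0]. *)
Definition wedge (v : V) : 'End(chain F V) :=
  lin_ext (fun s => if v \in s then 0
                    else (-1) ^+ vertex_pos v s *: elem (v |: s)).

Lemma wedge_elem_in v s : v \in s -> wedge v (elem s) = 0.
Proof. by move=> vs; rewrite lin_ext_elem vs. Qed.

Lemma wedge_elem_notin v s : v \notin s ->
  wedge v (elem s) = (-1) ^+ vertex_pos v s *: elem (v |: s).
Proof. by move=> /negPf vs; rewrite lin_ext_elem vs. Qed.

Lemma vertex_posU1 v w (s : {set V}) : v \notin s ->
  vertex_pos w (v |: s) = ((enum_rank v < enum_rank w) + vertex_pos w s)%N.
Proof. by move=> vs; rewrite (vertex_posD1 _ (setU11 v s)) setU1K. Qed.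

Lemma vertex_posD1id v (s : {set V}) : v \in s ->
  vertex_pos v (s :\ v) = vertex_pos v s.
Proof. by move=> vs; rewrite [RHS](vertex_posD1 _ vs) ltnn. Qed.

Lemma elem_wedge v s : v \in s ->
  elem s = (-1) ^+ vertex_pos v s *: wedge v (elem (s :\ v)).
Proof.
move=> vs; rewrite wedge_elem_notin ?setD11 // setD1K // vertex_posD1id //.
by rewrite scalerA -expr2 sqrr_sign scale1r.
Qed.

Lemma ltn_rank_neq (v w : V) : v != w ->
  (enum_rank w < enum_rank v)%N = ~~ (enum_rank v < enum_rank w)%N.
Proof.
by rewrite -(inj_eq enum_rank_inj) -val_eqE /=; case: ltngtP.
Qed.

(** The boundary is an antiderivation of the exterior algebra. With this rule, later identities
    about the boundary follow by adding one vertex at a time, without computing signs. *)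
Lemma boundary_wedge v c :
  boundary F V (wedge v c) = c - wedge v (boundary F V c).
Proof.
suff /lfunP/(_ c) : (boundary F V \o wedge v = \1 - (wedge v \o boundary F V))%VF.
  by rewrite !(add_lfunE, opp_lfunE, comp_lfunE, id_lfunE).
apply: hom_eq_elem => s; rewrite !(add_lfunE, opp_lfunE, comp_lfunE, id_lfunE) boundary_elem.
rewrite /simplex_boundary linear_sum.
have [vs|vs] := boolP (v \in s).
  rewrite wedge_elem_in // linear0 (bigD1 v) //= linearZ /= -elem_wedge //.
  rewrite big1 ?addr0 ?subrr // => w /andP[ws wv].
  by rewrite linearZ /= wedge_elem_in ?scaler0 // !inE vs eq_sym wv.
rewrite wedge_elem_notin // linearZ /= boundary_elem /simplex_boundary.
rewrite big_setU1 //= setU1K // scalerDr scalerA vertex_posU1 // ltnn.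
rewrite -expr2 sqrr_sign scale1r; congr (_ + _).
rewrite scaler_sumr -sumrN; apply: eq_bigr => w ws.
have wv : w != v by apply: contraNneq vs => <-.
rewrite [in RHS]linearZ /= wedge_elem_notin; last by rewrite !inE negb_and vs orbT.
rewrite !scalerA -scaleNr; congr (_ *: elem _); last first.
  apply/setP => u; rewrite !inE; case: (altP (u =P v)) => //= ->.
  by rewrite eq_sym wv.
rewrite vertex_posU1 // (vertex_posD1 v ws) (ltn_rank_neq wv) !exprD.
by case: ltngtP => _ /=; rewrite !(expr0, expr1, mulN1r, mul1r, mulrN, mulNr,
  opprK) // mulrC.
Qed.

(** Up to sign every simplex is an iterated wedge of its vertices applied to the unit, so induction
    on the cardinality applies. *)
Lemma hom_eq_wedge (W : finType) (f g : 'Hom(chain F V, chain F W)) :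
  f (elem set0) = g (elem set0) ->
  (forall v c, f c = g c -> f (wedge v c) = g (wedge v c)) -> f = g.
Proof.
move=> fg0 fgS; apply: hom_eq_elem => s.
have [k] := ubnP #|s|; elim: k s => // k IH s sk.
have [->//|[v vs]] := set_0Vmem s.
rewrite (elem_wedge vs) !linearZ /= (fgS v) // IH //.
by move: sk; rewrite (cardsD1 v) vs.
Qed.

End Wedge.

Arguments wedge {F V} v.

(** * Functoriality of chains under vertex maps *)

Section Pushforward.
Variables (F : fieldType).
Implicit Types U V W : finType.
Local Notation elem := (elem_chain F).

(** When [phi] is injective on [s], the parity is the sign of the permutation that sorts the images
    of the ordered vertices. *)
Definition inversions V W (phi : V -> W) (s : {set V}) : nat :=
  \sum_(u in s) \sum_(v in s)
    ((enum_rank u < enum_rank v) && (enum_rank (phi v) < enum_rank (phi u)))%N.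

Definition pushforward V W (phi : V -> W) : 'Hom(chain F V, chain F W) :=
  lin_ext (fun s : {set V} => if #|phi @: s| == #|s|
                    then (-1) ^+ inversions phi s *: elem (phi @: s) else 0).

(** The pushforward is multiplicative on the exterior algebra. Through [hom_eq_wedge] this yields
    both the chain map property and functoriality. *)
Lemma pushforward_wedge V W (phi : V -> W) v c :
  pushforward phi (wedge v c) = wedge (phi v) (pushforward phi c).
Proof.
suff /lfunP/(_ c) : (pushforward phi \o wedge v
                     = wedge (phi v) \o pushforward phi)%VF.
  by rewrite !comp_lfunE.
apply: hom_eq_elem => s; rewrite !comp_lfunE [in RHS]lin_ext_elem.
have [vs|vs] := boolP (v \in s).
  rewrite wedge_elem_in // linear0; case: ifP => _; last by rewrite linear0.
  by rewrite linearZ /= wedge_elem_in ?scaler0 // imset_f.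
rewrite wedge_elem_notin // linearZ /= lin_ext_elem imsetU1 cardsU1.
rewrite [in X in _ == X]cardsU1 vs /=.
have [/imset_injP injs|ninj] := boolP (#|phi @: s| == #|s|); last first.
  rewrite linear0 ifN ?scaler0 //; have := leq_imset_card phi s.
  by move: ninj; case: (_ \notin _); lia.
have [im|nim] := boolP (phi v \in phi @: s).
  rewrite ifN ?scaler0; last by have := leq_imset_card phi s; lia.
  by rewrite linearZ /= wedge_elem_in ?scaler0.
have cs : #|phi @: s| = #|s| by apply: card_in_imset.
rewrite cs eqxx [in RHS]linearZ /= wedge_elem_notin ?nim // !scalerA -!exprD.
congr (_ *: _); set a := (vertex_pos _ _ + _)%N; set b := (_ + _)%N.
suff [d ad] : exists d, a = (b + d.*2)%N.
  by rewrite ad exprD -mul2n exprM sqrrN expr1n expr1n mulr1.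
(* The two sign exponents differ by twice the number of [u] that precede [v] but whose image follows
   [phi v]. The identity [key] is checked for each [u] separately. *)
pose inv u := ((enum_rank u < enum_rank v)
               && (enum_rank (phi v) < enum_rank (phi u)))%N : nat.
exists (\sum_(u in s) inv u)%N; rewrite {}/a {}/b.
have pos1 : vertex_pos v s = (\sum_(u in s) (enum_rank u < enum_rank v))%N.
  by rewrite /vertex_pos cardsE -sum1_card big_mkcondr.
have pos2 : vertex_pos (phi v) (phi @: s)
    = (\sum_(u in s) (enum_rank (phi u) < enum_rank (phi v)))%N.
  rewrite /vertex_pos cardsE -sum1_card big_mkcondr big_imset //=.
rewrite pos1 pos2 /inversions big_setU1 //= big_setU1 //= ltnn add0n.
rewrite -muln2 big_distrl /=.
under [X in (_ + (_ + X))%N]eq_bigr => u us do rewrite big_setU1 //=.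
rewrite big_split /=.
suff key : (\sum_(u in s) (enum_rank u < enum_rank v)
    + \sum_(u in s) ((enum_rank v < enum_rank u)
                      && (enum_rank (phi u) < enum_rank (phi v)))
    + \sum_(u in s) inv u
    = \sum_(u in s) (enum_rank (phi u) < enum_rank (phi v))
      + \sum_(u in s) inv u * 2)%N.
  by rewrite !addnA key -[RHS]addnA [RHS]addnC.
rewrite -!big_split /=; apply: eq_bigr => u us; rewrite {}/inv.
have uv : u != v by apply: contraNneq vs => <-.
have puv : phi u != phi v.
  by apply: contraNneq nim => <-; apply: imset_f.
by rewrite (ltn_rank_neq uv) (ltn_rank_neq puv); do 2!case: (_ < _)%N.
Qed.

Lemma pushforward1 V W (phi : V -> W) :
  pushforward phi (elem set0) = elem set0.
Proof.
by rewrite lin_ext_elem imset0 !cards0 eqxx /inversions big_set0 scale1r.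
Qed.

Lemma boundary_pushforward V W (phi : V -> W) c :
  boundary F W (pushforward phi c) = pushforward phi (boundary F V c).
Proof.
suff /lfunP/(_ c) : (boundary F W \o pushforward phi
                     = pushforward phi \o boundary F V)%VF.
  by rewrite !comp_lfunE.
apply: hom_eq_wedge => [|v {}c]; rewrite !comp_lfunE.
  rewrite pushforward1 !boundary_elem /simplex_boundary !big_set0.
  by rewrite linear0.
move=> IH; rewrite pushforward_wedge !boundary_wedge linearB /=.
by rewrite pushforward_wedge -IH.
Qed.

Lemma pushforward_comp U V W (psi : V -> W) (phi : U -> V) c :
  pushforward (psi \o phi) c = pushforward psi (pushforward phi c).
Proof.
suff -> : pushforward (psi \o phi) = (pushforward psi \o pushforward phi)%VF.
  by rewrite comp_lfunE.
apply: hom_eq_wedge => [|v {}c]; rewrite ?comp_lfunE ?id_lfunE ?pushforward1 // => IH.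
by rewrite !pushforward_wedge -IH.
Qed.

Lemma pushforward_id V (c : chain F V) : pushforward id c = c.
Proof.
suff -> : @pushforward V V id = \1%VF by rewrite id_lfunE.
apply: hom_eq_wedge => [|v {}c]; rewrite ?comp_lfunE ?id_lfunE ?pushforward1 // => IH.
by rewrite pushforward_wedge IH.
Qed.

End Pushforward.

Arguments pushforward {F V W} phi.

(** * Simplicial maps and homotopy invariance under contiguity *)

Section SimplicialMaps.
Variables (F : fieldType).
Implicit Types V W : finType.
Local Notation elem := (elem_chain F).

(** Describes a wedge of [k] vertices with underlying set [t]. A repeated vertex makes it vanish, so
    the cardinality of [t] is imposed only in the other case and degenerate images need no separate
    treatment. *)
Definition simplex_multiple V (t : {set V}) (k : nat) (c : chain F V) : Prop :=
  c = 0 \/ #|t| = k /\ exists a, c = a *: elem t.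

Lemma simplex_multipleZ V (t : {set V}) k a c :
  simplex_multiple t k c -> simplex_multiple t k (a *: c).
Proof.
case=> [->|[tk [b ->]]]; first by left; rewrite scaler0.
by right; split=> //; exists (a * b); rewrite scalerA.
Qed.

Lemma simplex_multiple_wedge V (v : V) t k c :
  simplex_multiple t k c -> simplex_multiple (v |: t) k.+1 (wedge v c).
Proof.
case=> [->|[tk [b ->]]]; first by left; rewrite linear0.
rewrite linearZ /=; apply: simplex_multipleZ.
have [vt|vt] := boolP (v \in t); first by left; apply: wedge_elem_in.
right; rewrite cardsU1 vt tk; split=> //.
by exists ((-1) ^+ vertex_pos v t); apply: wedge_elem_notin.
Qed.

Lemma simplex_multiple_pushforward V W (phi : V -> W) (s : {set V}) :
  simplex_multiple (phi @: s) #|s| (pushforward phi (elem s)).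
Proof.
rewrite lin_ext_elem; case: eqP => [?|_]; last by left.
by right; split=> //; exists ((-1) ^+ inversions phi s).
Qed.

Lemma simplex_multiple_chains V (L : {set {set V}}) t k c :
  t \in L -> simplex_multiple t k.+1 c -> c \in chains F L k.
Proof.
move=> tL [->|[tk [a ->]]]; first exact: mem0v.
by apply/memvZ/memv_span/map_f; rewrite mem_enum inE tL tk eqxx.
Qed.

Lemma hom_chains V W (K : {set {set V}}) k (f : 'Hom(chain F V, chain F W))
    (X : {vspace chain F W}) c :
  (forall s, s \in K -> #|s| = k.+1 -> f (elem s) \in X) ->
  c \in chains F K k -> f c \in X.
Proof.
move=> fX cK; have: f c \in (f @: chains F K k)%VS by apply: memv_img.
apply: subvP; rewrite limg_span; apply/span_subvP => _ /mapP[_ /mapP[s + ->] ->].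
by rewrite mem_enum inE => /andP[sK /eqP]; apply: fX.
Qed.

Lemma memv_cycles V (K : {set {set V}}) k c :
  (c \in cycles F K k) = (c \in chains F K k) && (boundary F V c == 0).
Proof. by rewrite memv_cap memv_ker. Qed.

Section SimplicialMap.
Variables (V W : finType) (K : {set {set V}}) (L : {set {set W}}) (k : nat).
Implicit Types (phi psi : V -> W) (s : {set V}) (v : V) (w : W).

Definition simplicial (phi : V -> W) := forall s, s \in K -> phi @: s \in L.

Definition contiguous (phi psi : V -> W) :=
  forall s, s \in K -> phi @: s :|: psi @: s \in L.

Lemma pushforward_chains phi j c : simplicial phi ->
  c \in chains F K j -> pushforward phi c \in chains F L j.
Proof.
move=> sphi; apply: hom_chains => s sK sj; move: (sphi s sK).
move/simplex_multiple_chains; apply; rewrite -sj.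
exact: simplex_multiple_pushforward.
Qed.

Lemma pushforward_cycles phi c : simplicial phi ->
  c \in cycles F K k -> pushforward phi c \in cycles F L k.
Proof.
move=> sphi; rewrite !memv_cycles => /andP[cK /eqP c0].
by rewrite pushforward_chains // boundary_pushforward c0 linear0 eqxx.
Qed.

Lemma pushforward_boundaries phi c : simplicial phi ->
  c \in boundaries F K k -> pushforward phi c \in boundaries F L k.
Proof.
move=> sphi /memv_imgP[d dK ->]; rewrite -boundary_pushforward.
exact/memv_img/pushforward_chains.
Qed.

Definition update (phi : V -> W) v w : V -> W :=
  fun x => if x == v then w else phi x.

(* Splitting off [v], a simplex v ^ s is sent to w ^ phi(v) ^ phi(s), a chain
   homotopy between [phi] and [update phi v w]. *)
Definition prism (phi : V -> W) v w : 'Hom(chain F V, chain F W) :=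
  lin_ext (fun s => if v \in s then (-1) ^+ vertex_pos v s *:
     wedge w (wedge (phi v) (pushforward phi (elem (s :\ v)))) else 0).

Lemma prism_notin phi v w s : v \notin s -> prism phi v w (elem s) = 0.
Proof. by move=> /negPf vs; rewrite lin_ext_elem vs. Qed.

Lemma prism_wedge phi v w s : v \notin s ->
  prism phi v w (wedge v (elem s))
    = wedge w (wedge (phi v) (pushforward phi (elem s))).
Proof.
move=> vs; rewrite wedge_elem_notin // linearZ /= lin_ext_elem setU11.
by rewrite scalerA setU1K // vertex_posU1 // ltnn -expr2 sqrr_sign scale1r.
Qed.

Lemma eq_in_pushforward (phi psi : V -> W) s : {in s, phi =1 psi} ->
  pushforward phi (elem s) = pushforward psi (elem s).
Proof.
move=> eq_s; rewrite !lin_ext_elem (eq_in_imset eq_s); case: ifP => // _.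
congr ((-1) ^+ _ *: _); apply: eq_bigr => u us; apply: eq_bigr => x xs.
by rewrite !eq_s.
Qed.

(** Both sides vanish on simplices without [v]. On v ^ s the antiderivation rule, applied twice,
    gives phi(v) ^ phi(s) - w ^ phi(s) plus a term in the boundary of phi(s), which the second
    summand cancels. *)
Lemma prism_homotopy phi v w c :
  boundary F W (prism phi v w c) + prism phi v w (boundary F V c)
    = pushforward phi c - pushforward (update phi v w) c.
Proof.
have upd s : v \notin s ->
    pushforward (update phi v w) (elem s) = pushforward phi (elem s).
  move=> vs; apply: eq_in_pushforward => x xs; rewrite /update ifN //.
  by apply: contraNneq vs => <-.
suff /lfunP/(_ c) : ((boundary F W \o prism phi v w)
    + (prism phi v w \o boundary F V)
    = pushforward phi - pushforward (update phi v w))%VF.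
  by rewrite !(add_lfunE, opp_lfunE, comp_lfunE).
apply: hom_eq_elem => s; rewrite !(add_lfunE, opp_lfunE, comp_lfunE).
have [vs|vs] := boolP (v \in s); last first.
  rewrite prism_notin // linear0 add0r upd // subrr boundary_elem linear_sum.
  apply: big1 => x xs; rewrite linearZ /= prism_notin ?scaler0 //.
  by rewrite !inE negb_and vs orbT.
have vs' : v \notin s :\ v by rewrite setD11.
rewrite (elem_wedge F vs) !linearZ /= -!scalerDr; congr (_ *: _).
rewrite !pushforward_wedge upd // prism_wedge // !boundary_wedge.
rewrite [prism _ _ _ _]linearB /= prism_notin // sub0r.
suff -> : prism phi v w (wedge v (boundary F V (elem (s :\ v))))
    = wedge w (wedge (phi v) (boundary F W (pushforward phi (elem (s :\ v))))).
  by rewrite /update eqxx linearB /= opprB addrA addrAC addrK.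
rewrite boundary_pushforward boundary_elem !linear_sum /=.
apply: eq_bigr => x xs; rewrite !linearZ /= prism_wedge //.
by rewrite !inE eqxx andbF.
Qed.

Lemma prism_chains phi v w j c : contiguous phi (update phi v w) ->
  simplicial_complex L ->
  c \in chains F K j -> prism phi v w c \in chains F L j.+1.
Proof.
move=> ct [_ Ldown]; apply: hom_chains => s sK sj; rewrite lin_ext_elem.
case: ifP => vs; last exact: mem0v.
pose t := w |: (phi v |: phi @: (s :\ v)).
have tL : t \in L.
  apply: Ldown (ct s sK) _ _; first by apply/set0Pn; exists w; apply: setU11.
  apply/subsetP => y; rewrite !inE => /or3P[/eqP->|/eqP->|/imsetP[x]].
  - by apply/orP; right; apply/imsetP; exists v; rewrite // /update eqxx.
  - by rewrite imset_f.
  - by rewrite !inE => /andP[_ xs ->]; rewrite imset_f.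
apply: (simplex_multiple_chains tL); apply: simplex_multipleZ.
do 2!apply: simplex_multiple_wedge; have := cardsD1 v s; rewrite vs sj => -[->].
exact: simplex_multiple_pushforward.
Qed.

(** Turns [phi] into [psi] one vertex at a time, each change being a prism homotopy; the induction
    is on the number of vertices where they differ. *)
Lemma contiguous_homologous phi psi c :
  simplicial_complex L -> contiguous phi psi -> c \in cycles F K k ->
  pushforward phi c - pushforward psi c \in boundaries F L k.
Proof.
move=> Lc + cK.
have [n] := ubnP #|[set x | phi x != psi x]|.
elim: n phi => // n IH phi lt_n ct.
have [eq0|[v]] := set_0Vmem [set x | phi x != psi x].
  have -> : pushforward phi = pushforward psi :> 'Hom(chain F V, chain F W).
    apply: hom_eq_elem => s; apply: eq_in_pushforward => x _.
    by apply/eqP/negPn; have := in_set0 x; rewrite -eq0 inE => ->.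
  by rewrite subrr mem0v.
rewrite inE => nv; pose phi' := update phi v (psi v).
have phi'E x : phi' x = phi x \/ phi' x = psi x.
  by rewrite /phi' /update; case: eqP => [->|_]; [right | left].
(* Maps that agree at each vertex with [phi] or [psi] send a simplex into the union of its two
   images, so all intermediate maps are mutually contiguous. *)
have sub (g h : V -> W) : (forall x, g x = phi x \/ g x = psi x) ->
    (forall x, h x = phi x \/ h x = psi x) -> contiguous g h.
  move=> gE hE s sK; have [L0 Ldown] := Lc; apply: Ldown (ct s sK) _ _.
    apply: contraNneq L0 => /eqP; rewrite setU_eq0 => /andP[gs _].
    have : s == set0 by rewrite -(imset_eq0 g).
    by move=> /eqP s0; have := ct s sK; rewrite s0 !imset0 setU0.
  apply/subsetP => y /setUP[] /imsetP[x xs ->].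
    by case: (gE x) => ->; rewrite inE !imset_f ?orbT.
  by case: (hE x) => ->; rewrite inE !imset_f ?orbT.
have step : pushforward phi c - pushforward phi' c \in boundaries F L k.
  rewrite -prism_homotopy; move: cK; rewrite memv_cycles => /andP[cK /eqP->].
  rewrite linear0 addr0; apply/memv_img/prism_chains => //.
  by apply: sub => [x|]; [left|exact: phi'E].
rewrite -(subrKA (pushforward phi' c)); apply: memvD => //.
apply: IH; last by apply: sub => [|x]; [exact: phi'E|right].
rewrite -ltnS; apply: leq_trans lt_n; rewrite ltnS; apply: proper_card.
apply/properP; split; last by exists v; rewrite inE // /phi' /update !eqxx.
apply/subsetP => x; rewrite !inE /phi' /update.
by case: (altP (x =P v)) => // ->; rewrite eqxx.
Qed.

End SimplicialMap.

End SimplicialMaps.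

(** * Rank bound from a block unitriangular family of maps *)

Section TriangularRank.
Variables (F : fieldType) (X Y : vectType F) (Z B : {vspace X}).
Variables (Z' B' : {vspace Y}) (I : eqType).
Variables (S : I -> 'Hom(X, Y)) (R : I -> 'Hom(Y, X)) (w : I -> nat).
Hypothesis BZ : (B <= Z)%VS.
Hypothesis BZ' : (B' <= Z')%VS.
Hypothesis SZ : forall i x, x \in Z -> S i x \in Z'.
Hypothesis RB : forall i y, y \in B' -> R i y \in B.
Hypothesis RS1 : forall i x, x \in Z -> R i (S i x) - x \in B.
Hypothesis RS0 : forall i j x, i != j -> (w i <= w j)%N -> x \in Z ->
  R i (S j x) \in B.

(** Quotients are avoided: a complement [H] of [B] in [Z] stands for the homology. The images of [H]
    under the maps [S i] are shown to be independent of each other and of [B'], each with the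
    dimension of [H]. *)
Lemma triangular_rank (s : seq I) : uniq s ->
  (size s * (\dim Z - \dim B) <= \dim Z' - \dim B')%N.
Proof.
pose H := (Z :\: B)%VS.
have HZ : (H <= Z)%VS by apply: diffvSl.
have dH : \dim H = (\dim Z - \dim B)%N.
  by rewrite -(dimv_cap_compl Z B) (capv_idPr BZ) addKn.
wlog: s / sorted (fun i j => (w i <= w j)%N) s.
  pose r i j := (w i <= w j)%N => IH us.
  rewrite -(size_sort r); apply: IH; last by rewrite sort_uniq.
  by apply: sort_sorted => i j; apply: leq_total.
move=> srt us.
pose Q (t : seq I) := (B' + \sum_(i <- t) (S i @: H))%VS.
have QZ t : (Q t <= Z')%VS.
  rewrite subv_add BZ' /=; elim: t => [|i t IH]; first by rewrite big_nil sub0v.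
  rewrite big_cons subv_add IH andbT; apply/subvP => _ /memv_imgP[x xH ->].
  by apply/SZ/(subvP HZ).
suff dQ : \dim (Q s) = (\dim B' + size s * \dim H)%N.
  by rewrite -dH -(leq_add2l (\dim B')) -dQ subnKC ?dimvS.
elim: s srt us => [|i s IH] /= srt; first by rewrite /Q big_nil addv0 addn0.
move=> /andP[si us]; rewrite mulSn addnCA -IH //; last exact: path_sorted srt.
have QiE : Q (i :: s) = (S i @: H + Q s)%VS.
  by rewrite /Q big_cons addvA (addvC B') -addvA.
(* The list increases in weight, so [RS0] applies to [i] and every later index: [R i] kills modulo
   [B] all that has been accumulated. *)
have RQ y : y \in Q s -> R i y \in B.
  move=> /memv_addP[b /RB bB [z + ->]]; rewrite linearD => zs.
  apply: memvD; first exact: bB.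
  have : all (fun j => (w i <= w j)%N) s.
    apply: order_path_min srt => a b' c; exact: leq_trans.
  elim: {IH srt us QiE b bB} s si z zs => [|j s IH] /=.
    by move=> _ z; rewrite big_nil memv0 => /eqP->; rewrite linear0 mem0v.
  rewrite inE negb_or big_cons => /andP[ij si] z /memv_addP[_ /memv_imgP[x xH ->]].
  move=> [z' z's ->] /andP[wj ws]; rewrite linearD.
  apply: memvD; last exact: IH.
  by apply: RS0 => //; apply: (subvP HZ).
(* On [H], by contrast, [R i] after [S i] is the identity modulo [B], and [H] meets [B] only in 0.
   This gives both disjointness from [Q s] and injectivity of [S i] on [H]. *)
have SH x : x \in H -> S i x \in Q s -> x = 0.
  move=> xH /RQ RSx; have xZ := subvP HZ x xH.
  have xB : x \in B by have := memvB RSx (RS1 i xZ); rewrite subKr.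
  apply/eqP; rewrite -memv0 -(capv_diff Z B) memv_cap xB andbT; exact: xH.
rewrite QiE dimv_disjoint_sum; last first.
  apply/eqP; rewrite -subv0; apply/subvP => y.
  rewrite memv_cap => /andP[/memv_imgP[x xH ->] /(SH _ xH) ->].
  by rewrite linear0 mem0v.
congr (_ + _)%N; apply: limg_dim_eq; apply/eqP; rewrite -subv0.
apply/subvP => x; rewrite memv_cap memv_ker => /andP[xH /eqP Sx].
by rewrite (SH x) ?mem0v // Sx mem0v.
Qed.

End TriangularRank.

(** * Complexes of intersecting families and their induced maps *)

Section IntersectingFamilies.
Variables (F : fieldType) (n q : nat).
Hypothesis n_gt0 : (0 < n)%N.
Local Notation KG a := (VR_subsets n a (2 * (n - 1))).

(** The distance is 2(n - |A :&: B|), so the bound excludes exactly the disjoint pairs; [n_gt0]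
    keeps [n - 1] from truncating. *)
Lemma symdiff_dist_intersect a (A B : {set 'I_a}) : #|A| = n -> #|B| = n ->
  (symdiff_dist A B <= 2 * (n - 1))%N = (A :&: B != set0).
Proof.
move=> An Bn; rewrite /symdiff_dist -card_gt0.
have := cardsUI (A :\: B) (B :\: A).
have -> : (A :\: B) :&: (B :\: A) = set0.
  by apply/setP => x; rewrite !inE; case: (x \in A); case: (x \in B).
have := cardsID B A; have := cardsID A B; rewrite cards0 [B :&: A]setIC.
lia.
Qed.

Lemma KGP a (s : {set {set 'I_a}}) :
  reflect [/\ s != set0, {in s, forall A : {set 'I_a}, #|A| = n}
            & {in s &, forall A B, A :&: B != set0}]
          (s \in KG a).
Proof.
rewrite inE; apply: (iffP and3P) => -[s0 sn sI]; split=> //.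
- by move=> A /(subsetP sn); rewrite inE => /eqP.
- move=> A B As Bs; rewrite -symdiff_dist_intersect.
  + by have /forall_inP/(_ A As)/forall_inP/(_ B Bs) := sI.
  + by have := subsetP sn A As; rewrite inE => /eqP.
  + by have := subsetP sn B Bs; rewrite inE => /eqP.
- by apply/subsetP => A As; rewrite inE sn.
- apply/forall_inP => A As; apply/forall_inP => B Bs.
  by rewrite symdiff_dist_intersect ?sn // sI.
Qed.

(** A relation rather than one chosen map, so that it also covers composites of induced maps and the
    identity. *)
Definition dominates a b (f : 'I_a -> 'I_b)
    (phi : {set 'I_a} -> {set 'I_b}) : Prop :=
  forall A : {set 'I_a}, #|A| = n -> #|phi A| = n /\ f @: A \subset phi A.

(** If [x] lies in both [A] and [B], then [f x] lies in any set containing [f @: A] and any set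
    containing [f @: B], so the chosen sets still meet. *)
Lemma dominates_contiguous a b (f : 'I_a -> 'I_b) phi psi :
  dominates f phi -> dominates f psi -> contiguous (KG a) (KG b) phi psi.
Proof.
move=> fphi fpsi s /KGP[s0 sn sI].
have E C : C \in phi @: s :|: psi @: s ->
    #|C| = n /\ exists2 A, A \in s & f @: A \subset C.
  case/setUP=> /imsetP[A As ->].
    by have [-> ?] := fphi A (sn A As); split=> //; exists A.
  by have [-> ?] := fpsi A (sn A As); split=> //; exists A.
apply/KGP; split=> [|C /E[]//|C D /E[_ [A As AC]] /E[_ [B Bs BD]]].
  have /set0Pn[A As] := s0; apply/set0Pn; exists (phi A).
  by rewrite inE imset_f.
have /set0Pn[x /setIP[xA xB]] := sI A B As Bs.
apply/set0Pn; exists (f x); rewrite inE.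
by rewrite (subsetP AC) ?(subsetP BD) ?imset_f.
Qed.

Lemma dominates_simplicial a b (f : 'I_a -> 'I_b) phi :
  dominates f phi -> simplicial (KG a) (KG b) phi.
Proof.
by move=> fphi s sK; rewrite -[_ @: _]setUid (dominates_contiguous fphi fphi).
Qed.

Lemma dominates_comp a b c (g : 'I_b -> 'I_c) (f : 'I_a -> 'I_b) psi phi :
  dominates g psi -> dominates f phi -> dominates (g \o f) (psi \o phi).
Proof.
move=> gpsi fphi A /fphi[/gpsi[-> sub2] sub1]; split=> //.
by rewrite imset_comp (subset_trans _ sub2) ?imsetS.
Qed.

Definition extension b (B : {set 'I_b}) : {set 'I_b} :=
  B :|: [set x in take (n - #|B|) (enum (~: B))].

Definition induced a b (f : 'I_a -> 'I_b) (A : {set 'I_a}) : {set 'I_b} :=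
  extension (f @: A).

Lemma card_extension b (B : {set 'I_b}) :
  (n <= b)%N -> (#|B| <= n)%N -> #|extension B| = n.
Proof.
move=> nb Bn; set t := take (n - #|B|) (enum (~: B)).
have tB : [disjoint B & [set x in t]].
  rewrite disjoint_sym disjoint_subset; apply/subsetP => x; rewrite inE.
  by move/mem_take; rewrite mem_enum inE.
have := cardsUI B [set x in t]; rewrite (eqP (_ : _ :&: _ == set0)); last first.
  by rewrite setI_eq0.
rewrite cards0 addn0 => ->; rewrite cardsE (card_uniqP _) ?take_uniq ?enum_uniq //.
rewrite size_take -cardE; have := cardsC B; rewrite card_ord.
by case: ltnP; lia.
Qed.

Lemma dominates_induced a b (f : 'I_a -> 'I_b) :
  (n <= b)%N -> dominates f (induced f).
Proof.
move=> nb A An; split; last exact: subsetUl.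
by apply: card_extension => //; rewrite -An leq_imset_card.
Qed.

Lemma dominates_homologous a b (f : 'I_a -> 'I_b) phi psi c :
  dominates f phi -> dominates f psi -> c \in cycles F (KG a) q ->
  pushforward phi c - pushforward psi c \in boundaries F (KG b) q.
Proof.
move=> fphi fpsi; apply: contiguous_homologous.
  exact: vietoris_rips_complex.
exact: dominates_contiguous fphi fpsi.
Qed.

Lemma not_surjective_null a p (f : 'I_a -> 'I_p.+2) t phi c :
  (n <= p.+1)%N -> t \notin codom f -> dominates f phi ->
  cycles F (KG p.+1) q = boundaries F (KG p.+1) q ->
  c \in cycles F (KG a) q -> pushforward phi c \in boundaries F (KG p.+2) q.
Proof.
move=> np tf fphi null cK.
(* As [f] misses [t], the default is never taken and [f] factors as [lift t \o g] through a set with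
   one element fewer. *)
pose g x : 'I_p.+1 := odflt ord0 (unlift t (f x)).
have fE : lift t \o g =1 f.
  move=> x; rewrite /= /g; case: unliftP => [j ->//|ft].
  by case/negP: tf; rewrite -ft codom_f.
have dg : dominates g (induced g) by apply: dominates_induced.
have dt : dominates (lift t) (induced (lift t)).
  by apply: dominates_induced; lia.
have df : dominates f (induced (lift t) \o induced g).
  by move=> A /(dominates_comp dt dg); rewrite (eq_imset _ fE).
rewrite -(subrK (pushforward (induced (lift t) \o induced g) c)
                (pushforward phi c)).
apply: memvD; first exact: dominates_homologous fphi df cK.
rewrite pushforward_comp.
apply: pushforward_boundaries; first exact: dominates_simplicial dt.
by rewrite -null; apply: pushforward_cycles cK; apply: dominates_simplicial dg.
Qed.

End IntersectingFamilies.

(** * Step functions of subsets and their least sections *)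

Section StepFunctions.
Variable M : nat.
Implicit Types T U : {set 'I_M}.

Definition step T (x : nat) : nat := #|[set t in T | (t < x)%N]|.

Lemma step_max T x : (step T x <= #|T|)%N.
Proof. by apply/subset_leq_card/subsetP => t; rewrite inE => /andP[]. Qed.

Lemma stepM T : step T M = #|T|.
Proof. by apply: eq_card => t; rewrite inE ltn_ord andbT. Qed.

Lemma step0 T : step T 0 = 0%N.
Proof. by apply/eqP; rewrite cards_eq0; apply/eqP/setP => t; rewrite !inE andbF. Qed.

Lemma stepS T (y : 'I_M) : step T y.+1 = ((y \in T) + step T y)%N.
Proof.
rewrite /step (cardsD1 y) !inE ltnSn andbT; congr (_ + _)%N.
apply: eq_card => t; rewrite !inE -val_eqE /= ltnS.
by case: ltngtP; rewrite ?andbF ?andbT.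
Qed.

Lemma step_homo T x y : (x <= y)%N -> (step T x <= step T y)%N.
Proof.
move=> xy; apply/subset_leq_card/subsetP => t; rewrite !inE => /andP[->] /=.
by move/leq_trans; apply.
Qed.

(** The starting point [ord_max] is a valid candidate whenever [j <= #|T|], by [stepM]. *)
Definition section T (j : nat) : 'I_M.+1 :=
  [arg min_(x < ord_max | (j <= step T x)%N) (x : nat)].

Lemma section_le T j (x : 'I_M.+1) : (j <= step T x)%N -> (section T j <= x)%N.
Proof.
move=> jx; rewrite /section; case: arg_minnP => [|y _]; last exact.
by rewrite stepM (leq_trans jx) ?step_max.
Qed.

(** The step function starts at 0 and rises by at most one, so it cannot jump over [j] at the first
    point where it reaches [j]. *)
Lemma step_section T j : (j <= #|T|)%N -> step T (section T j) = j.
Proof.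
move=> jT; rewrite /section; case: arg_minnP => [|[[|y] yM] /= jy ymin].
- by rewrite stepM.
- by move: jy; rewrite step0; case: j {jT ymin}.
apply/eqP; rewrite eqn_leq jy andbT.
have yM' : (y < M)%N by [].
have := stepS T (Ordinal yM') => /= ->.
have : ~~ (j <= step T y)%N.
  by apply/negP => /(ymin (Ordinal (ltnW yM))); rewrite /= ltnn.
by case: (_ \in _); lia.
Qed.

(* The injective composite is nondecreasing, so [j <= step T (section U j)]. *)
Lemma step_le_of_injective T U : #|T| = #|U| ->
  {in [pred j | (j <= #|U|)%N] &, injective (fun j => step T (section U j))} ->
  forall x : 'I_M.+1, (step U x <= step T x)%N.
Proof.
move=> TU inj x.
have le j : (j <= #|U|)%N -> (j <= step T (section U j))%N.
  elim: j => // j IH jU; apply: leq_ltn_trans (IH (ltnW jU)) _.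
  rewrite ltn_neqAle; apply/andP; split.
    by apply/eqP => /inj E; have := E (ltnW jU) jU; lia.
  apply/step_homo/section_le; rewrite step_section //; exact: ltnW.
(* Take [j = step U x], whose section is at most [x]. *)
apply: leq_trans (le _ (step_max U x)) _.
by apply: step_homo; apply: section_le.
Qed.

(** A numerical refinement of the pointwise order of step functions, used to sort the blocks of the
    triangular matrix. *)
Definition step_weight T : nat := \sum_(x < M.+1) step T x.

Lemma step_weight_inj T U : (step_weight T <= step_weight U)%N ->
  (forall x : 'I_M.+1, (step U x <= step T x)%N) -> T = U.
Proof.
move=> wTU le.
have E (x : 'I_M.+1) : step U x = step T x.
  have [leW eqW] := leqif_sum (fun x (_ : true) => leqif_eq (le x)).
  have : step_weight U == step_weight T by rewrite eqn_leq leW wTU.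
  by rewrite eqW => /forallP/(_ x)/eqP.
(* The increment of the step function at [t] records whether [t] belongs to the set. *)
apply/setP => t.
have := E (Ordinal (ltn_ord t : t.+1 < M.+1)%N).
have := E (Ordinal (ltnW (ltn_ord t : t.+1 < M.+1)%N)).
by rewrite /= !stepS => -> /addIn; case: (t \in T); case: (t \in U).
Qed.

End StepFunctions.

(** * The binomial count and the rank inequality, with l = p + 2 and m = M + 1 *)

Lemma hockey_stick M p :
  (\sum_(p.+2 <= i < M.+2) 'C(i - 2, p.+2 - 2) = 'C(M, p.+1))%N.
Proof.
elim: M => [|M IH]; first by rewrite big_geq.
have [pM|Mp] := leqP p M; last by rewrite big_geq ?bin_small //; lia.
by rewrite big_nat_recr //= IH !subSS !subn0 binS.
Qed.

Lemma homology_rank_binomial (F : fieldType) n q p M : (0 < n)%N ->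
  (n <= p.+1)%N -> (p.+1 <= M)%N ->
  cycles F (VR_subsets n p.+1 (2 * (n - 1))) q
    = boundaries F (VR_subsets n p.+1 (2 * (n - 1))) q ->
  ('C(M, p.+1) * homology_rank F (VR_subsets n p.+2 (2 * (n - 1))) q
    <= homology_rank F (VR_subsets n M.+1 (2 * (n - 1))) q)%N.
Proof.
move=> n0 np pM null.
pose I : finType := {T : {set 'I_M} | #|T| == p.+1}.
pose r (T : I) (x : 'I_M.+1) : 'I_p.+2 := inord (step (val T) x).
pose s (T : I) (j : 'I_p.+2) : 'I_M.+1 := section (val T) j.
have cT (T : I) : #|val T| = p.+1 by apply/eqP/(valP T).
have rE T x : r T x = step (val T) x :> nat.
  by rewrite inordK // ltnS (leq_trans (step_max _ _)) ?cT.
have dr T : dominates n (r T) (induced n (r T)).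
  by apply: dominates_induced; lia.
have ds T : dominates n (s T) (induced n (s T)).
  by apply: dominates_induced; lia.
have -> : 'C(M, p.+1) = size (enum I).
  by rewrite -cardE card_sig -[in RHS]cardsE card_draws card_ord.
apply: (@triangular_rank F _ _ _ _ _ _ I
  (fun T => pushforward (induced n (s T)))
  (fun T => pushforward (induced n (r T)))
  (fun T => step_weight (val T))); last exact: enum_uniq.
- exact/boundaries_sub_cycles/vietoris_rips_complex.
- exact/boundaries_sub_cycles/vietoris_rips_complex.
- by move=> T x; apply/pushforward_cycles/dominates_simplicial.
- by move=> T x; apply/pushforward_boundaries/dominates_simplicial.
(* Diagonal blocks: [r T \o s T] is the identity, so the composite of induced maps and the identity
   dominate the same function. *)
- move=> T x xZ; rewrite -pushforward_comp -[X in _ - X]pushforward_id.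
  apply: dominates_homologous (dominates_comp (dr T) (ds T)) _ xZ => // A An.
  split=> //; rewrite (_ : _ @: A = A) //.
  rewrite -[RHS]imset_id; apply: eq_imset => j; apply: val_inj.
  by rewrite /= rE step_section // cT -ltnS.
move=> T U x TU wTU xZ; rewrite -pushforward_comp.
(* If the composite were injective, [step U] would lie below [step T], and the weights would force
   [T = U]. Otherwise this self-map of a finite set is not surjective and acts as zero. *)
have [/injectiveP inj|ninj] := boolP (injectiveb (r T \o s U)).
  case/eqP: TU; apply/val_inj/step_weight_inj => //.
  apply: step_le_of_injective => [|i j]; first by rewrite !cT.
  rewrite !inE cT => ip jp eq_ij.
  have : inord i = inord j :> 'I_p.+2.
    by apply: inj; apply: val_inj; rewrite /= !rE /s !inordK.
  by move/(congr1 val); rewrite /= !inordK.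
have [t tf] : exists t, t \notin codom (r T \o s U).
  apply/existsP; rewrite -negb_forall; apply: contra ninj => /forallP surj.
  apply/injectiveP => i j; apply: (elimT (@image_injP _ _ (r T \o s U) predT)) => //.
  apply/eqP/eq_card => t; exact: surj.
exact: (not_surjective_null n0 np tf (dominates_comp (dr T) (ds U))) xZ.
Qed.

(** The full set is the only vertex, so there are no simplices of positive dimension. *)
Lemma homology_rank_diagonal (F : fieldType) n q : (0 < n)%N -> (0 < q)%N ->
  homology_rank F (VR_subsets n n (2 * (n - 1))) q = 0%N.
Proof.
move=> n0 q0; apply/eqP; rewrite -leqn0.
suff c0 : chains F (VR_subsets n n (2 * (n - 1))) q = 0%VS.
  by rewrite /homology_rank /cycles c0 cap0v dimv0 sub0n.
apply/eqP; rewrite -subv0; apply/span_subvP => _ /mapP[s + ->].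
rewrite mem_enum inE => /andP[/(KGP n0)[_ sn _] /eqP sq].
have : s \subset [set setT].
  apply/subsetP => A /sn An; rewrite inE eqEcard subsetT cardsT card_ord An.
  exact: leqnn.
by move/subset_leq_card; rewrite sq cards1; lia.
Qed.

Theorem theorem5p2 (R : realType) (n q l : nat)
  (hn : (1 <= n)%N) (hq : (1 <= q)%N) (hl : (n <= l)%N)
  (hnontriv : homology_nontrivial R (VR_subsets n l (2 * (n - 1))) q)
  (hmin : forall k : nat, (n <= k)%N ->
    homology_nontrivial R (VR_subsets n k (2 * (n - 1))) q -> (l <= k)%N) :
  forall m : nat, (l <= m)%N ->
    (\sum_(l <= i < m.+1)
        'C(i - 2, l - 2) * homology_rank R (VR_subsets n l (2 * (n - 1))) q
     <= homology_rank R (VR_subsets n m (2 * (n - 1))) q)%N.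
Proof.
(* Minimality speaks only about sizes at least [n]; the strict inequality lets it be applied to l -
   1. *)
have n_lt_l : (n < l)%N.
  rewrite ltn_neqAle hl andbT; apply: contraTneq isT => nl; subst l.
  move/homology_nontrivialP: hnontriv.
  by rewrite homology_rank_diagonal // => /(_ (vietoris_rips_complex _ _ _)).
case: l => [|[|p]] in hl hnontriv hmin n_lt_l *; [by lia..|].
case=> // M pM; rewrite -big_distrl /= hockey_stick.
apply: homology_rank_binomial => //.
(* Nontrivial homology at l - 1 = p + 1 would contradict minimality. *)
apply/eqP; apply/negPn/negP => /eqP /(hmin p.+1 n_lt_l).
by rewrite ltnn.
Qed.
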